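(* For each even integer $L\ge 2$ there is an irrational number $x=[a_0,a_1,a_2,\ldots]$ with all $a_i\in\{1,2,3,4\}$ and eventually periodic sequence of partial quotients, such that its Jacobi sequence is eventually periodic with repeating block $1,1,\ldots,1,-1$ of length $L$ (the value $1$ repeated $L-1$ times followed by $-1$). Furthermore, there are uncountably many distinct Jacobi sequences that are not eventually periodic and that are Jacobi sequences of irrational numbers $x=[a_0,a_1,a_2,\ldots]$ with all $a_i\in\{1,2,3,4\}$.
   Context: For $x\in\mathbb{R}\setminus\mathbb{Q}$ with regular continued fraction expansion $x=[a_0,a_1,a_2,\ldots]$, the convergents $s_k/t_k$ are defined by $s_{-1}=1$, $s_0=a_0$, $s_k=a_ks_{k-1}+s_{k-2}$ and $t_{-1}=0$, $t_0=1$, $t_k=a_kt_{k-1}+t_{k-2}$ for $k\ge1$. For an odd natural number $n$ and an integer $m$ coprime to $n$, $\left(\frac{m}{n}\right)$ is the usual Jacobi symbol (equal to $1$ if $n=1$); if $n$ is even and $\gcd(m,n)=1$, one sets $\left(\frac{m}{n}\right)=*$, a fixed symbol different from $\pm1$. The Jacobi sequence of $x$ is $\left(\frac{s_k}{t_k}\right)$, $k\ge 0$. *)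

(* Defs.v *)
From HB Require Import structures.
From mathcomp Require Import all_boot all_order all_algebra.
From mathcomp Require Import reals.
Set Implicit Arguments. Unset Strict Implicit. Unset Printing Implicit Defensive.
Import Order.TTheory GRing.Theory Num.Theory.
Local Open Scope ring_scope.

Fixpoint cf_rem (R : realType) (x : R) (k : nat) : R :=
  match k with
  | 0 => x
  | k'.+1 => ((cf_rem x k') - (Num.floor (cf_rem x k'))%:~R)^-1
  end.

Definition cf_digit (R : realType) (x : R) (k : nat) : int :=
  Num.floor (cf_rem x k).

(* conv a k = (s_k, s_{k-1}, t_k, t_{k-1}) *)
Fixpoint conv (a : nat -> int) (k : nat) : int * int * int * int :=
  match k with
  | 0 => (a 0%N, 1, 1, 0)
  | k'.+1 =>
      let: (s, s', t, t') := conv a k' in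
      (a k * s + s', s, a k * t + t', t)
  end.

Definition conv_num (a : nat -> int) (k : nat) : int := (conv a k).1.1.1.
Definition conv_den (a : nat -> int) (k : nat) : int := (conv a k).1.2.

(* Legendre symbol (m / p) for an odd prime p, via Euler's criterion. *)
Definition legendre (m : int) (p : nat) : int :=
  let r := (m %% p%:Z)%Z in
  if r == 0 then 0
  else if ((r ^+ (p.-1 %/ 2)) %% p%:Z)%Z == 1 then 1 else -1.

Definition jacobi (m : int) (n : nat) : int :=
  \prod_(p <- primes n) legendre m p ^+ logn p n.

(* Values of the Jacobi sequence: Some v for v = (m/n) when n is odd,
   None stands for the symbol * (n even). *)
Definition jacobi_val (m n : int) : option int :=
  if odd `|n|%N then Some (jacobi m `|n|%N) else None.

Definition jacobi_seq (a : nat -> int) (k : nat) : option int :=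
  jacobi_val (conv_num a k) (conv_den a k).

Definition jacobi_seq_of (R : realType) (x : R) : nat -> option int :=
  jacobi_seq (cf_digit x).

Definition eventually_periodic (T : Type) (u : nat -> T) : Prop :=
  exists N p : nat, (0 < p)%N /\ forall k, (N <= k)%N -> u (k + p)%N = u k.

Definition digits_1_4 (R : realType) (x : R) : Prop :=
  forall k, 1 <= cf_digit x k <= 4.

Definition block_L (L N k : nat) : option int :=
  if ((k - N) %% L == L.-1)%N then Some (-1) else Some 1.

(* Main.v *)
Require Import Defs.
From HB Require Import structures.
From mathcomp Require Import all_boot all_order all_algebra all_solvable all_field.
From mathcomp Require Import classical_sets reals zify ring.
Import Order.TTheory GRing.Theory Num.Theory.
Local Open Scope ring_scope.

(** From [s_k t_(k-1) = (-1)^(k-1)] modulo [t_k], the symbol [(s_k/t_k)] equals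
    [((-1)^(k-1)/t_k) (t_(k-1)/t_k)]. Take [a_0 = a_1 = 1] and [a_k] in [{2, 4}] for [k >= 2]:
    every [t_k] is odd, and [t_k] is [t_(k-2)] modulo 4 if [a_k = 4] and [t_(k-2) + 2] if
    [a_k = 2], so the residues of the [t_k] modulo 4 can be prescribed. If [t_k = 1] modulo 4
    for all odd [k], quadratic reciprocity gives [(t_k/t_(k+1)) = (t_(k+1)/t_k) = (t_(k-1)/t_k)],
    hence all these symbols are 1, and [(s_k/t_k)] is [-1] exactly for the even [k] with
    [t_k = 3] modulo 4. So any sequence of signs that is [1] at 0 and at all odd places is a
    Jacobi sequence: for the first part put [-1] at the positive multiples of [L]; for the
    second, diagonalise along multiples of 4 and mark the squares on the class of 2 modulo 4
    in order to prevent periodicity.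
    Quadratic reciprocity is obtained from Gauss sums over a finite field of characteristic
    [q] containing a nontrivial [p]-th root of unity. *)

(** * Euler's criterion and the quadratic character of a prime field *)

(** [X^h - 1] has at most [h] roots, fewer than there are nonzero elements. This yields both
    quadratic nonresidues and roots of unity. *)
Lemma exists_expf_neq1 (F : finFieldType) (h : nat) :
  (0 < h < #|F|.-1)%N -> exists2 x : F, x != 0 & x ^+ h != 1.
Proof.
case/andP=> h0 hF.
have [/existsP[x /andP[x0 xh]]|] := boolP [exists x : F, (x != 0) && (x ^+ h != 1)].
  by exists x.
rewrite negb_exists => /forallP H.
have Pn0 : ('X^h - 1 : {poly F}) != 0 by rewrite -size_poly_gt0 size_XnsubC.
have := @max_poly_roots _ _ (enum (predC1 (0 : F))) Pn0.
rewrite size_XnsubC // -cardE cardC1 => /(_ _ (enum_uniq _)) H'.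
have : (#|F|.-1 < h.+1)%N.
  apply: H'; apply/allP => x; rewrite mem_enum inE => x0.
  move: (H x); rewrite x0 /= negbK => /eqP xh.
  by rewrite rootE !hornerE xh subrr.
by rewrite ltnS leqNgt hF.
Qed.

(** The Legendre symbol on residue classes, a character that can be summed over the field. *)
Definition chi (p : nat) (x : 'F_p) : int :=
  if x == 0 then 0 else if x ^+ (p.-1 %/ 2) == 1 then 1 else -1.

Lemma intr_Fp_eq (p : nat) (a b : int) : prime p ->
  (a %% p%:Z)%Z = (b %% p%:Z)%Z <-> a%:~R = b%:~R :> 'F_p.
Proof.
move=> pp; have E : ((a %% p%:Z)%Z == (b %% p%:Z)%Z) = (a%:~R == b%:~R :> 'F_p).
  by rewrite eqz_mod_dvd (dvdz_pcharf (pchar_Fp pp)) rmorphB subr_eq0.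
by split=> /eqP; [rewrite E|rewrite -E] => /eqP.
Qed.

Lemma legendreE (m : int) (p : nat) : prime p -> legendre m p = chi p (m%:~R).
Proof.
move=> pp; have p1 := prime_gt1 pp.
have E (a b : int) : ((a %% p%:Z)%Z == (b %% p%:Z)%Z) = (a%:~R == b%:~R :> 'F_p).
  by apply/eqP/eqP => /(intr_Fp_eq _ _ _ pp).
rewrite /legendre /chi.
have -> : ((m %% p)%Z == 0) = (m%:~R == 0 :> 'F_p).
  by rewrite -(E m 0) mod0z.
case: ifP => // _.
have <- : (1 %% p%:Z)%Z = 1 by rewrite modz_nat modn_small.
rewrite E rmorphXn /=.
have -> : ((m %% p)%Z)%:~R = m%:~R :> 'F_p by apply/intr_Fp_eq => //; rewrite modz_mod.
by [].
Qed.

Section OddPrime.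
Variables (p : nat).
Hypotheses (pp : prime p) (op : odd p).
Let h := (p.-1 %/ 2)%N.

Let p_gt2 : (2 < p)%N.
Proof. by have := prime_gt1 pp; case: p op => [|[|[|]]]. Qed.

Let pE : p = h.*2.+1.
Proof. by rewrite /h divn2; lia. Qed.

Let F2_neq0 : (2 : 'F_p) != 0.
Proof. by rewrite -(dvdn_pcharf (pchar_Fp pp)) gtnNdvd. Qed.

Let one_neq_opp1 : (1 : 'F_p) != -1.
Proof. by rewrite -subr_eq0 opprK. Qed.

Lemma chi_euler (x : 'F_p) : (chi p x)%:~R = x ^+ h.
Proof.
rewrite /chi; case: eqP => [->|/eqP x0].
  by rewrite expr0n; case: eqP => //; lia.
case: eqP => [-> //|/eqP xh].
have /eqP : (x ^+ h) ^+ 2 = 1.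
  rewrite -exprM; apply: (mulfI x0); rewrite mulr1 -exprS.
  by rewrite muln2 -pE -[in X in _ ^+ X](card_Fp pp) expf_card.
by rewrite sqrf_eq1 (negPf xh) /= => /eqP ->; rewrite rmorphN1.
Qed.

Lemma chi_sqr1 (x : 'F_p) : x != 0 -> chi p x ^+ 2 = 1.
Proof. by rewrite /chi => /negPf ->; case: ifP. Qed.

Lemma chi_cases (x : 'F_p) : [\/ chi p x = 0, chi p x = 1 | chi p x = -1].
Proof.
rewrite /chi; case: ifP => _; first by constructor 1.
by case: ifP => _; [constructor 2|constructor 3].
Qed.

(** A sign is determined by its image in ['F_p], because 1 and -1 differ there. *)
Lemma chi_eq (x : 'F_p) (e : int) : e ^+ 2 = 1 -> x ^+ h = e%:~R -> chi p x = e.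
Proof.
move=> /eqP; rewrite sqrf_eq1 -chi_euler => /orP[] /eqP -> {e};
case: (chi_cases x) => -> //= /eqP; rewrite ?rmorph0 ?rmorph1 ?rmorphN1.
- by rewrite eq_sym (negPf one_neq_opp1).
- by rewrite eq_sym oppr_eq0 oner_eq0.
- by rewrite (negPf one_neq_opp1).
Qed.

Lemma chiM (x y : 'F_p) : chi p (x * y) = chi p x * chi p y.
Proof.
have [->|x0] := eqVneq x 0; first by rewrite mul0r /chi eqxx mul0r.
have [->|y0] := eqVneq y 0; first by rewrite mulr0 /chi eqxx mulr0.
by apply: chi_eq; rewrite ?exprMn ?chi_sqr1 // rmorphM /= !chi_euler.
Qed.

(** Multiplication by a nonresidue permutes the field and negates the sum. *)
Lemma sum_chi : \sum_x chi p x = 0.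
Proof.
have [|b b0 bh] := @exists_expf_neq1 'F_p h; first by rewrite card_Fp //; lia.
have cb : chi p b = -1 by rewrite /chi (negPf b0) (negPf bh).
have : \sum_x chi p x = - \sum_x chi p x.
  rewrite -[RHS]mulN1r -cb mulr_sumr (reindex_inj (mulfI b0)) /=.
  by apply: eq_bigr => x _; rewrite chiM.
by move=> ?; lia.
Qed.

End OddPrime.

(** * Gauss sums and quadratic reciprocity for primes *)

Section GaussSum.
Variables (p q : nat) (K : fieldType) (z : K).
Hypotheses (pp : prime p) (op : odd p) (pq : prime q) (oq : odd q) (npq : p != q).
Hypotheses (zp : z ^+ p = 1) (z1 : z != 1) (chK : q \in [pchar K]).

Definition add_char (x : 'F_p) : K := z ^+ x.

Lemma add_charD (x y : 'F_p) : add_char (x + y) = add_char x * add_char y.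
Proof. by rewrite /add_char /= -exprD [X in (_ %% X)%N]Fp_cast // expr_mod. Qed.

Lemma add_char1 : add_char 1 = z.
Proof. by rewrite /add_char /= Fp_cast // expr_mod // expr1. Qed.

Lemma add_charMn (x : 'F_p) (n : nat) : add_char (x *+ n) = add_char x ^+ n.
Proof.
elim: n => [|n IH]; first by rewrite mulr0n expr0 /add_char expr0.
by rewrite mulrS add_charD IH exprS.
Qed.

(** Orthogonality: translating the variable by 1 multiplies the sum by [z], which is not 1. *)
Lemma sum_add_char (c : 'F_p) :
  \sum_x add_char (c * x) = if c == 0 then p%:R else 0.
Proof.
case: eqP => [->|/eqP c0].
  under eq_bigr => x _ do rewrite mul0r /add_char expr0.
  by rewrite sumr_const card_Fp.
have <- : \sum_x add_char x = \sum_x add_char (c * x).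
  by rewrite (reindex_inj (mulfI c0)).
have /eqP : \sum_x add_char x = z * \sum_x add_char x.
  rewrite {1}(reindex_inj (addrI 1)) /= mulr_sumr.
  by apply: eq_bigr => x _; rewrite add_charD add_char1.
rewrite -subr_eq0 -{1}[X in X - _]mul1r -mulrBl mulf_eq0 subr_eq0 eq_sym (negPf z1).
by move=> /eqP.
Qed.

Definition gauss_sum : K := \sum_x (chi p x)%:~R * add_char x.

Lemma gauss_sum_sqr : gauss_sum ^+ 2 = (p%:Z * chi p (-1))%:~R.
Proof.
(* For [x = 0] both sides vanish, the right one because [chi] sums to 0. *)
have inner (x : 'F_p) : (chi p x)%:~R * add_char x * gauss_sum =
    \sum_u (chi p u)%:~R * add_char ((1 + u) * x).
  have [->|x0] := eqVneq x 0.
    rewrite {1}/chi eqxx !mul0r.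
    under eq_bigr => u _ do rewrite mulr0 /add_char expr0 mulr1.
    by rewrite -rmorph_sum sum_chi.
  rewrite /gauss_sum (reindex_inj (mulfI x0)) mulr_sumr; apply: eq_bigr => u _.
  rewrite mulrDl mul1r add_charD (mulrC u) (chiM _ pp op) rmorphM /=.
  transitivity (((chi p x) ^+ 2)%:~R * (chi p u)%:~R * (add_char x * add_char (x * u))).
    by rewrite rmorphXn /=; ring.
  by rewrite chi_sqr1 // mul1r.
rewrite expr2 {1}/gauss_sum mulr_suml.
under eq_bigr => x _ do rewrite inner.
(* With the sums exchanged, orthogonality kills every term except [u = -1]. *)
rewrite exchange_big /=.
under eq_bigr => u _ do rewrite -mulr_sumr sum_add_char.
rewrite (bigD1 (-1)) //= subrr eqxx big1 ?addr0 => [|u u1].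
  by rewrite rmorphM /= mulrC.
by rewrite addrC addr_eq0 (negPf u1) mulr0.
Qed.

Lemma q_Fp_neq0 : (q%:R : 'F_p) != 0.
Proof. by rewrite -(dvdn_pcharf (pchar_Fp pp)) dvdn_prime2. Qed.

(** The [q]-th power is additive in characteristic [q], fixes the values of [chi] since [q] is odd,
    and multiplies the argument of [add_char] by [q]; reindexing pulls out the factor. *)
Lemma gauss_sum_frobenius : gauss_sum ^+ q = (chi p q%:R)%:~R * gauss_sum.
Proof.
rewrite -(pFrobenius_autE chK) rmorph_sum.
rewrite /gauss_sum [in RHS](reindex_inj (mulfI q_Fp_neq0)) mulr_sumr.
apply: eq_bigr => x _; rewrite [LHS](pFrobenius_autE chK) exprMn -add_charMn mulr_natl mulrA.
congr (_ * _); rewrite -rmorphXn -rmorphM -[x *+ q]mulr_natl (chiM _ pp op) /=; congr (_%:~R).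
rewrite mulrA -expr2 chi_sqr1 ?q_Fp_neq0 // mul1r.
case: (chi_cases p x) => -> //; first by rewrite expr0n; case: (q) oq.
  by rewrite expr1n.
by rewrite -signr_odd oq expr1.
Qed.

(** Write [gauss_sum ^+ q] as [gauss_sum] times a power of its square, compare with Frobenius and
    cancel; the sum is nonzero because its square is [p] up to sign. *)
Lemma gauss_sum_euler :
  (chi p q%:R)%:~R = (p%:Z * chi p (-1))%:~R ^+ (q.-1 %/ 2) :> K.
Proof.
have g0 : gauss_sum != 0.
  rewrite -sqrf_eq0 gauss_sum_sqr -(dvdz_pcharf chK).
  have qp : ~~ (q %| p)%N by rewrite dvdn_prime2 // eq_sym.
  rewrite [chi p (-1)]/chi oppr_eq0 oner_eq0.
  by case: ifP => _; rewrite ?mulr1 ?mulrN1 dvdzE ?abszN.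
apply: (mulIf g0); rewrite -gauss_sum_frobenius -gauss_sum_sqr -exprM -exprSr.
congr (_ ^+ _); move: oq; rewrite divn2; lia.
Qed.

End GaussSum.

Lemma chi_neg1 (p : nat) : prime p -> odd p -> chi p (-1) = (-1) ^+ (p.-1 %/ 2).
Proof.
by move=> pp op; apply: chi_eq; rewrite ?sqrr_sign // rmorphXn rmorphN1.
Qed.

Lemma legendre_reciprocity (p q : nat) : prime p -> odd p -> prime q -> odd q -> p != q ->
  legendre q p = (-1) ^+ ((p.-1 %/ 2) * (q.-1 %/ 2)) * legendre p q.
Proof.
move=> pp op pq oq npq; rewrite !legendreE //.
(* By Fermat, [p] divides the order [q ^ (p - 1) - 1] of the unit group, so this field contains a
   nontrivial [p]-th root of unity. *)
have [K chK cardK] : {K : finFieldType | q \in [pchar K] & #|K| = (q ^ p.-1)%N}.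
  by apply: pPrimePowerField => //; have := prime_gt1 pp; case: (p) => [|[]].
have dvdp : (p %| #|K|.-1)%N.
  have : (q ^ p.-1 = 1 %[mod p])%N.
    rewrite -(totient_prime pp); apply: Euler_exp_totient.
    by rewrite coprime_sym prime_coprime // dvdn_prime2.
  move/eqP; rewrite eqn_mod_dvd ?expn_gt0 ?prime_gt0 //.
  by rewrite cardK subn1.
have K1 : (0 < #|K|.-1)%N by rewrite -subn1 subn_gt0 finNzRing_gt1.
have [|x x0 xh] := @exists_expf_neq1 K (#|K|.-1 %/ p).
  by rewrite divn_gt0 ?prime_gt0 // dvdn_leq //= ltn_Pdiv // prime_gt1.
have zp : (x ^+ (#|K|.-1 %/ p)) ^+ p = 1.
  rewrite -exprM divnK //; apply: (mulfI x0).
  by rewrite mulr1 -exprS prednK ?expf_card // ltnW // finNzRing_gt1.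
have := gauss_sum_euler _ _ _ _ pp op pq oq npq zp xh chK.
(* An equality of integers in [K] is a congruence modulo [q], so it can be read in ['F_q], where
   Euler's criterion applies. *)
rewrite -rmorphXn => /eqP; rewrite -subr_eq0 -rmorphB -(dvdz_pcharf chK).
rewrite (dvdz_pcharf (pchar_Fp pq)) rmorphB subr_eq0 !rmorphXn rmorphM /=.
rewrite chi_neg1 // => /eqP H.
have q0 : (q%:R : 'F_p) != 0 by apply: q_Fp_neq0.
rewrite -(chi_eq _ pq oq _ _ _ (esym H)); last exact: chi_sqr1.
rewrite (chiM _ pq oq) mulrC; congr (_ * _).
by rewrite rmorphXn rmorphN1; apply: chi_eq; rewrite ?sqrr_sign // -exprM rmorphXn rmorphN1.
Qed.

(** * Jacobi symbols *)

(** A range of primes independent of [n] lets symbols with different lower entries be multiplied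
    factor by factor. *)
Lemma jacobi_iota (m : int) (n N : nat) : (0 < n)%N -> (n < N)%N ->
  jacobi m n = \prod_(0 <= p < N | prime p) legendre m p ^+ logn p n.
Proof.
move=> n0 nN; rewrite /jacobi.
have P : perm_eq (primes n) [seq p <- index_iota 0 N | p \in primes n].
  apply: uniq_perm; rewrite ?primes_uniq ?filter_uniq ?iota_uniq // => p.
  rewrite mem_filter mem_index_iota leq0n /=; case: (boolP (p \in primes n)) => //.
  by rewrite mem_primes => /and3P[_ _ /dvdn_leq pn]; rewrite (leq_ltn_trans _ nN) ?pn.
rewrite (perm_big _ P) big_filter big_mkcond [RHS]big_mkcond; apply: eq_bigr => p _.
rewrite mem_primes n0 /=; case: (boolP (prime p)) => //= pp.
case: (boolP (p %| n)%N) => // pn.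
by rewrite (_ : logn p n = 0%N) //; apply/eqP; rewrite -leqn0 leqNgt logn_gt0 mem_primes pp n0.
Qed.

Lemma jacobi1r (m : int) : jacobi m 1 = 1.
Proof. by rewrite /jacobi big_nil. Qed.

Lemma jacobi_prime (m : int) (p : nat) : prime p -> jacobi m p = legendre m p.
Proof. by move=> pp; rewrite /jacobi primes_prime // big_seq1 logn_prime // eqxx expr1. Qed.

Lemma jacobiMr (m : int) (a b : nat) : (0 < a)%N -> (0 < b)%N ->
  jacobi m (a * b) = jacobi m a * jacobi m b.
Proof.
move=> a0 b0; have ab0 : (0 < a * b)%N by rewrite muln_gt0 a0.
rewrite !(jacobi_iota _ _ (a * b).+1) ?ltnS ?leq_pmulr ?leq_pmull // -big_split /=.
by apply: eq_bigr => p _; rewrite lognM // exprD.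
Qed.

Lemma odd_prime_ind (P : nat -> Prop) : P 1%N ->
  (forall p n, prime p -> odd p -> odd n -> P n -> P (p * n)%N) ->
  forall n, odd n -> P n.
Proof.
move=> P1 PM n; have [N] := ubnP n; elim: N n => // N IH n nN on.
have [->//|n1] := eqVneq n 1%N.
have n_gt1 : (1 < n)%N by case: n on n1 {nN} => [|[]].
have pp := pdiv_prime n_gt1; rewrite -(divnK (pdiv_dvd n)) mulnC.
have := on; rewrite -{1}(divnK (pdiv_dvd n)) oddM => /andP[o1 o2].
apply: PM => //; apply: IH => //; rewrite ltnS in nN; apply: leq_trans nN.
by rewrite ltn_Pdiv ?prime_gt1 // ltnW.
Qed.

Lemma legendreM (m m' : int) (p : nat) : prime p -> odd p ->
  legendre (m * m') p = legendre m p * legendre m' p.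
Proof. by move=> pp op; rewrite !legendreE // rmorphM chiM. Qed.

Lemma jacobiMl (m m' : int) (n : nat) : odd n ->
  jacobi (m * m') n = jacobi m n * jacobi m' n.
Proof.
move: n; apply: odd_prime_ind => [|p n pp op on IH]; first by rewrite !jacobi1r.
rewrite !(jacobiMr _ p n) ?odd_gt0 // IH !(jacobi_prime _ p) // legendreM //.
by rewrite mulrACA.
Qed.

Lemma eq_jacobi_mod (m m' : int) (n : nat) : (n %| m - m')%Z -> jacobi m n = jacobi m' n.
Proof.
move=> H; apply: eq_big_seq => p; rewrite mem_primes => /and3P[pp _ pn].
rewrite !legendreE //; congr (chi _ _ ^+ _); apply/intr_Fp_eq => //.
by apply/eqP; rewrite eqz_mod_dvd (dvdz_trans _ H).
Qed.

(** For odd [n], the second binary digit tells 3 from 1 modulo 4. *)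
Definition mod4_3 (n : nat) : bool := odd n./2.

Lemma mod4_3M (m n : nat) : odd m -> odd n -> mod4_3 (m * n) = mod4_3 m (+) mod4_3 n.
Proof.
rewrite /mod4_3 => om on; rewrite -(odd_double_half m) -(odd_double_half n) om on.
set a := m./2; set b := n./2.
have -> : ((true + a.*2) * (true + b.*2) = (a + b + (a * b).*2).*2.+1)%N.
  by nia.
by rewrite !add1n /= !uphalf_double !oddD odd_double addbF.
Qed.

Lemma jacobi1l (n : nat) : odd n -> jacobi 1 n = 1.
Proof.
move: n; apply: odd_prime_ind => [|p n pp op on IH]; first by rewrite jacobi1r.
rewrite jacobiMr ?odd_gt0 // IH jacobi_prime // legendreE //.
by rewrite /chi oner_eq0 expr1n eqxx.
Qed.

Lemma jacobi_neg1 (n : nat) : odd n -> jacobi (-1) n = (-1) ^+ mod4_3 n.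
Proof.
move: n; apply: odd_prime_ind => [|p n pp op on IH]; first by rewrite jacobi1r.
rewrite jacobiMr ?odd_gt0 // IH jacobi_prime // legendreE //.
rewrite rmorphN1 chi_neg1 // mod4_3M // signr_addb -signr_odd.
by congr ((-1) ^+ _ * _); congr (nat_of_bool _); rewrite /mod4_3 divn2; congr odd; lia.
Qed.

(** The exponent is additive modulo 2 in each argument, so induction on the upper entry, then on the
    lower one, reduces to pairs of primes. *)
Lemma jacobi_reciprocity (m n : nat) : odd m -> odd n -> coprime m n ->
  jacobi m n = (-1) ^+ (mod4_3 m && mod4_3 n) * jacobi n m.
Proof.
have sgnD (a b c : bool) : (-1) ^+ (a && (b (+) c)) = (-1) ^+ (a && b) * (-1) ^+ (a && c) :> int.
  by case: a; rewrite ?signr_addb ?mul1r.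
have prime_case p : prime p -> odd p -> forall m, odd m -> coprime m p ->
    jacobi m p = (-1) ^+ (mod4_3 p && mod4_3 m) * jacobi p m.
  move=> pp op; apply: odd_prime_ind => [_|q k pq oq ok IH].
    by rewrite jacobi1r jacobi1l // andbF.
  rewrite coprimeMl => /andP[cqp ckp].
  rewrite PoszM jacobiMl // IH // jacobiMr ?odd_gt0 // mod4_3M // sgnD.
  rewrite (jacobi_prime _ p) // (jacobi_prime _ q) // (legendre_reciprocity p q) //; last first.
    by apply: contraTneq cqp => ->; rewrite prime_coprime // dvdnn.
  rewrite -signr_odd oddM mulrACA; congr ((-1) ^+ nat_of_bool (_ && _) * _ * _).
    by rewrite /mod4_3 divn2; congr odd; lia.
  by rewrite /mod4_3 divn2; congr odd; lia.
move=> om; move: n; apply: odd_prime_ind => [_|p k pp op ok IH].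
  by rewrite jacobi1r jacobi1l // andbF.
rewrite coprimeMr => /andP[cmp cmk].
rewrite PoszM jacobiMl // jacobiMr ?odd_gt0 // IH // (prime_case p) //.
by rewrite mod4_3M // sgnD mulrACA (andbC (mod4_3 p)).
Qed.

(** * Denominators prescribed modulo 4 and their Jacobi sequences *)

(* These digits produce denominators [t_k] that are odd, with [t_k = 3] modulo 4 iff [e k]. *)
Definition cf_digits_of (e : nat -> bool) (k : nat) : int :=
  if (k < 2)%N then 1 else if e k == e (k - 2)%N then 4 else 2.

Lemma mod4_3D (d t t' : nat) : (d == 2) || (d == 4) -> odd t -> odd t' ->
  mod4_3 (d * t + t') = mod4_3 t' (+) (d == 2).
Proof.
rewrite /mod4_3 => dE ot ot'; rewrite -(odd_double_half t) -(odd_double_half t') ot ot'.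
set a := t./2; set b := t'./2; case/orP: dE => /eqP ->.
  have -> : (2 * (true + a.*2) + (true + b.*2) = (b + 1 + a.*2).*2.+1)%N.
    by nia.
  by rewrite !add1n /= !uphalf_double !oddD odd_double addbF.
have -> : (4 * (true + a.*2) + (true + b.*2) = (b + (1 + a.*2).*2).*2.+1)%N.
  by nia.
by rewrite !add1n /= !uphalf_double !oddD odd_double !addbF.
Qed.

(** Invariant for consecutive convergents; it starts at index 1 because [t_(-1) = 0] is even. *)
Lemma conv_cf_digits_of (e : nat -> bool) (k : nat) :
  ~~ e 0%N -> (forall i, odd i -> ~~ e i) ->
  exists s s' : int, exists t t' : nat,
    [/\ conv (cf_digits_of e) k.+1 = (s, s', t%:Z, t'%:Z),
        [/\ odd t, odd t' & coprime t' t],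
        mod4_3 t' = e k /\ mod4_3 t = e k.+1,
        s * t' - s' * t = (-1) ^+ k & jacobi t' t = 1].
Proof.
move=> e0 eodd; elim: k => [|k [s [s' [t [t' [E [ot ot' cop] [m' m] det J]]]]]].
  exists 2, 1, 1%N, 1%N; split => //=.
    by rewrite (negPf e0) (negPf (eodd 1%N isT)).
  by rewrite jacobi1r.
pose d := if e k.+2 == e k then 4%N else 2%N.
have dE : (d == 2%N) || (d == 4%N) by rewrite /d; case: ifP.
have od : odd (d * t + t') by rewrite oddD oddM ot'; case/orP: dE => /eqP ->.
have m2 : mod4_3 (d * t + t') = e k.+2.
  by rewrite mod4_3D // m' /d; case: (e k.+2); case: (e k).
have cop2 : coprime t (d * t + t') by rewrite /coprime gcdnMDl gcdnC.
exists (d%:Z * s + s'), s, (d * t + t')%N, t; split => //.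
- rewrite /= in E *; rewrite E /cf_digits_of /= subn2 /= PoszD PoszM.
  by rewrite /d; case: ifP.
- by rewrite exprS -det PoszD PoszM; ring.
rewrite jacobi_reciprocity // m m2 (eq_jacobi_mod _ t'); last first.
  by rewrite PoszD PoszM addrK dvdz_mull.
(* One of [k.+1], [k.+2] is odd, so consecutive denominators are never both 3 modulo 4 and
   reciprocity carries no sign. *)
rewrite J mulr1; case: (boolP (odd k)) => ok.
  by rewrite (negPf (eodd k.+2 _)) ?andbF /= ?negbK.
by rewrite (negPf (eodd k.+1 _)).
Qed.

Lemma jacobi_seq_cf_digits_of (e : nat -> bool) (k : nat) :
  ~~ e 0%N -> (forall i, odd i -> ~~ e i) ->
  jacobi_seq (cf_digits_of e) k = Some ((-1) ^+ e k).
Proof.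
move=> e0 eodd; case: k => [|k]; first by rewrite (negPf e0) /jacobi_seq /jacobi_val /= jacobi1r.
have [s [s' [t [t' [E [ot ot' cop] [m' m] det J]]]]] := conv_cf_digits_of e k e0 eodd.
rewrite /jacobi_seq /jacobi_val /conv_num /conv_den E /= ot; congr Some.
(* Multiply by [jacobi t' t], which is 1: by the determinant, [s * t'] is [(-1) ^+ k] modulo [t]. *)
rewrite -[LHS]mulr1 -[X in _ * X]J -jacobiMl // (eq_jacobi_mod _ ((-1) ^+ k)); last first.
  by rewrite -det opprB addrC subrK dvdz_mull.
rewrite -[(-1) ^+ k]signr_odd; case: (boolP (odd k)) => ok.
  by rewrite expr1 jacobi_neg1 // m.
by rewrite expr0 jacobi1l // (negPf (eodd k.+1 _)).
Qed.

(** * Continued fractions with prescribed digits *)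

Definition cf_shift (a : nat -> int) (k : nat) : int := a k.+1.

Fixpoint cf_value (R : realType) (a : nat -> int) (k : nat) : R :=
  if k is k'.+1 then (a 0%N)%:~R + (cf_value R (cf_shift a) k')^-1 else (a 0%N)%:~R.

(** Replaces convergence of the continued fraction to [x]: these inequalities pass to tails, so
    digits can be read off without limits. *)
Definition interlaced (R : realType) (a : nat -> int) (x : R) : Prop :=
  forall k, if odd k then x < cf_value R a k else cf_value R a k < x.

Lemma cf_value_ge1 (R : realType) (a : nat -> int) (k : nat) :
  (forall i, 1 <= a i) -> 1 <= cf_value R a k.
Proof.
elim: k a => [|k IH] a a1 /=; first by rewrite (ler_int _ 1).
have := IH (cf_shift a) (fun i => a1 i.+1) => H.
apply: ler_wpDr; last by rewrite (ler_int _ 1).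
by rewrite invr_ge0 (le_trans ler01).
Qed.

(** Inversion reverses the order, so each step of the recursion swaps the parities. *)
Lemma cf_value_alternate (R : realType) (a : nat -> int) (n m : nat) :
  (forall i, 1 <= a i) -> (n < m)%N ->
  if odd n then cf_value R a m < cf_value R a n else cf_value R a n < cf_value R a m.
Proof.
elim: n m a => [|n IH] [|m] a a1 //= nm.
  by rewrite ltrDl invr_gt0 (lt_le_trans ltr01) // cf_value_ge1 // => i; apply: a1.
have a1' i : 1 <= cf_shift a i by apply: a1.
have pos k : 0 < cf_value R (cf_shift a) k by rewrite (lt_le_trans ltr01) ?cf_value_ge1.
have := IH m _ a1' nm.
by case: (odd n) => /= H; rewrite ltrD2l ltf_pV2 ?posrE.
Qed.

Lemma exists_interlaced (R : realType) (a : nat -> int) :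
  (forall i, 1 <= a i) -> exists x : R, interlaced R a x.
Proof.
move=> a1; pose E : set R := fun y => exists k, y = cf_value R a k.*2.
have ub k : ubound E (cf_value R a k.*2.+1).
  move=> _ [l ->]; have [kl|lk] := ltnP k.*2.+1 l.*2.
    by have := cf_value_alternate R a _ _ a1 kl; rewrite /= odd_double /= => /ltW.
  have {}lk : (l.*2 < k.*2.+1)%N by lia.
  by have := cf_value_alternate R a _ _ a1 lk; rewrite /= odd_double /= => /ltW.
have supE : has_sup E.
  by split; [exists (cf_value R a 0), 0%N|exists (cf_value R a 1); apply: (ub 0%N)].
exists (sup E) => k; case: (boolP (odd k)) => ok.
  (* The supremum only gives weak inequalities; comparing with the convergent two places further
     makes them strict. *)
  apply: (@le_lt_trans _ _ (cf_value R a k.+2)).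
    apply: ge_sup; first by case: supE.
    have -> : k.+2 = (k.+1)./2.*2.+1 by lia.
    exact: ub.
  by have := cf_value_alternate R a k k.+2 a1; rewrite ok; apply; lia.
apply: (@lt_le_trans _ _ (cf_value R a k.+2)).
  by have := cf_value_alternate R a k k.+2 a1; rewrite (negPf ok); apply; lia.
apply: sup_upper_bound => //; exists (k.+2)./2; congr cf_value; lia.
Qed.

(** The first two convergents give [a_0 < x < a_0 + 1/a_1], and [1/a_1] is at most 1. *)
Lemma interlaced_floor (R : realType) (a : nat -> int) (x : R) :
  (forall i, 1 <= a i) -> interlaced R a x -> Num.floor x = a 0%N.
Proof.
move=> a1 H; have [H0 H1] := (H 0%N, H 1%N); rewrite /= in H0 H1.
apply: floor_def; rewrite (ltW H0) /=; apply: (lt_le_trans H1); rewrite rmorphD lerD2l /=.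
by rewrite invf_le1 ?(ltr_int _ 0) ?(ler_int _ 1) /cf_shift ?a1 // (lt_le_trans _ (a1 _)).
Qed.

Lemma interlaced_shift (R : realType) (a : nat -> int) (x : R) :
  (forall i, 1 <= a i) -> interlaced R a x ->
  interlaced R (cf_shift a) (x - (a 0%N)%:~R)^-1.
Proof.
move=> a1 H k.
have pos : 0 < cf_value R (cf_shift a) k.
  by rewrite (lt_le_trans ltr01) ?cf_value_ge1 // => i; apply: a1.
have x0 : 0 < x - (a 0%N)%:~R by rewrite subr_gt0; apply: (H 0%N).
have := H k.+1; rewrite /= ; case: (odd k) => /= H'.
  by rewrite -[ltRHS]invrK ltf_pV2 ?posrE ?invr_gt0 // ltrBrDl.
by rewrite -[ltLHS]invrK ltf_pV2 ?posrE ?invr_gt0 // ltrBlDl.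
Qed.

Lemma cf_digit_interlaced (R : realType) (a : nat -> int) (x : R) :
  (forall i, 1 <= a i) -> interlaced R a x -> cf_digit x =1 a.
Proof.
move=> a1 H k.
have iterE j i : iter j cf_shift a i = a (j + i)%N.
  by elim: j i => //= j IH i; rewrite /cf_shift IH addnS.
have ge1 j i : 1 <= iter j cf_shift a i by rewrite iterE.
have step : interlaced R (iter k cf_shift a) (cf_rem x k).
  elim: k => //= k IH; have := interlaced_shift _ _ _ (ge1 k) IH.
  by rewrite -(interlaced_floor _ _ _ (ge1 k) IH).
by rewrite /cf_digit (interlaced_floor _ _ _ (ge1 k) step) iterE addn0.
Qed.

Lemma cf_rem_inv (R : realType) (x : R) (k : nat) :
  cf_rem (x - (Num.floor x)%:~R)^-1 k = cf_rem x k.+1.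
Proof. by elim: k => //= k ->. Qed.

(* When the remainder reaches an integer, the next one is [0^-1 = 0], so the next digit is 0. *)
Lemma rational_cf_digit0 (R : realType) (x : R) (p : int) (q : nat) :
  (0 < q)%N -> x = p%:~R / q%:R -> exists k, cf_digit x k.+1 = 0.
Proof.
have [N] := ubnP q; elim: N q p x => // N IH q p x qN q0 xE.
have qR : 0 < q%:R :> R by rewrite ltr0n.
pose r : int := p - Num.floor x * q%:Z.
have rE : x - (Num.floor x)%:~R = r%:~R / q%:R.
  by rewrite rmorphB rmorphM /= mulrBl -xE mulfK ?gt_eqF.
have r0 : 0 <= r.
  by rewrite -(ler_int R) -(pmulr_lge0 _ (x := q%:R^-1)) ?invr_gt0 // -rE subr_ge0 floor_le_tmp.
have rq : r < q.
  by rewrite -(ltr_int R) -[ltRHS]mul1r -ltr_pdivrMr // -rE ltrBlDl -(intrD _ _ 1) lt_succ_floor.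
have [r_eq|rn0] := eqVneq r 0.
  by exists 0%N; rewrite /cf_digit /= rE r_eq mul0r invr0 floor0.
(* Euclid's algorithm: the next remainder is [q / r], with smaller denominator [r]. *)
have [|||k kE] := IH `|r|%N q%:Z (x - (Num.floor x)%:~R)^-1.
- lia.
- lia.
- by rewrite rE invf_div natr_absz ger0_norm.
by exists k.+1; rewrite /cf_digit -cf_rem_inv.
Qed.

Lemma irrational_of_cf_digit (R : realType) (x : R) : digits_1_4 x -> irrational x.
Proof.
move=> H [r _ rx].
have [||k k0] := rational_cf_digit0 R x (numq r) `|denq r|%N.
- by rewrite absz_gt0 denq_neq0.
- by rewrite natr_absz ger0_norm ?denq_ge0 // -rx /ratr.
by have := H k.+1; rewrite k0.
Qed.

(** * Irrational numbers with prescribed Jacobi sequences *)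

Lemma exists_jacobi_seq_of (R : realType) (e : nat -> bool) :
  ~~ e 0%N -> (forall i, odd i -> ~~ e i) ->
  exists x : R, [/\ irrational x, digits_1_4 x, cf_digit x =1 cf_digits_of e &
    forall k, jacobi_seq_of x k = Some ((-1) ^+ e k)].
Proof.
move=> e0 eodd; have dE i : 1 <= cf_digits_of e i <= 4.
  by rewrite /cf_digits_of; case: ifP => // _; case: ifP.
have ge1 i : 1 <= cf_digits_of e i by case/andP: (dE i).
have [x /(cf_digit_interlaced _ _ _ ge1) xE] := exists_interlaced R _ ge1.
have d14 : digits_1_4 x by move=> k; rewrite xE.
exists x; split=> //; first exact: irrational_of_cf_digit.
have convE k : conv (cf_digit x) k = conv (cf_digits_of e) k.
  by elim: k => [|k IH] /=; rewrite ?IH !xE.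
move=> k; rewrite -jacobi_seq_cf_digits_of //.
by rewrite /jacobi_seq_of /jacobi_seq /conv_num /conv_den convE.
Qed.

Lemma not_eventually_periodic_squares (u : nat -> bool) :
  (forall m, u (4 * m + 2)%N = [exists i : 'I_m.+1, i * i == m]%N) ->
  ~ eventually_periodic (fun k => Some ((-1) ^+ u k) : option int).
Proof.
move=> uE [N [p [p0 per]]].
(* Four times the period preserves residues modulo 4. *)
have per4 k : (N <= k)%N -> u (k + 4 * p)%N = u k.
  have per1 j : (N <= j)%N -> u (j + p)%N = u j.
    by move=> /per []; case: (u _); case: (u _).
  by move=> Nk; rewrite (_ : k + 4 * p = k + p + p + p + p)%N ?per1 //; lia.
(* [i >= N] reaches the periodic range; [i >= p] puts [i * i + p] strictly between consecutive
   squares. *)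
pose i := (N + p)%N.
have ui : u (4 * (i * i) + 2)%N.
  rewrite uE; apply/existsP; have iP : (i < (i * i).+1)%N by rewrite /i; nia.
  by exists (Ordinal iP).
have := per4 (4 * (i * i) + 2)%N.
rewrite ui (_ : 4 * (i * i) + 2 + 4 * p = 4 * (i * i + p) + 2)%N; last by lia.
rewrite uE => /(_ _)/existsP[|j /eqP jE]; first by rewrite /i; nia.
have [ji|ij] := leqP j i; [nia|].
by rewrite /i in ij jE *; nia.
Qed.

Theorem theorem7 (R : realType) :
  (forall L : nat, (2 <= L)%N -> ~~ odd L ->
    exists x : R, irrational x /\ digits_1_4 x /\
      eventually_periodic (cf_digit x) /\
      exists N : nat, forall k : nat, (N <= k)%N ->
        jacobi_seq_of x k = block_L L N k)
  /\
  (~ exists f : nat -> (nat -> option int),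
       forall J : nat -> option int,
         ~ eventually_periodic J ->
         (exists x : R, irrational x /\ digits_1_4 x /\
            forall k, jacobi_seq_of x k = J k) ->
         exists n : nat, forall k, f n k = J k).
Proof.
split=> [L L2 oL|[f fP]].
  pose e k := (0 < k)%N && (L %| k)%N.
  have eodd i : odd i -> ~~ e i.
    by apply: contraL => /andP[_ /dvdnP[c ->]]; rewrite oddM (negPf oL) andbF.
  have [//|x [xirr d14 xE xJ]] := exists_jacobi_seq_of R e _ eodd.
  exists x; split=> //; split=> //; split.
    (* The digit at [k] compares [e] at [k] and [k - 2], and [e] is [L]-periodic only from index 1
       on, since [e 0] is false. *)
    exists 3, L; split=> [|k k3]; first lia.
    have eL j : (0 < j)%N -> e (j + L)%N = e j.
      by move=> j0; rewrite /e addn_gt0 j0 dvdn_addl.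
    rewrite !xE /cf_digits_of eL; last lia.
    rewrite (_ : k + L - 2 = k - 2 + L)%N ?eL; try lia.
    by rewrite !(ltnNge _ 2) (leq_trans _ (leq_addr L k)) ?(ltnW k3).
  (* Blocks start at index 1, so that each one ends at a multiple of [L]. *)
  exists 1%N => -[//|k] _; rewrite xJ /block_L subn1 /= /e /=.
  have -> : (k %% L == L.-1)%N = (L %| k.+1)%N.
    rewrite /dvdn -[in RHS]addn1 -modnDml.
    have := ltn_pmod k (ltnW L2); set r := (k %% L)%N => rL.
    have [->|rn] := eqVneq r L.-1; first by rewrite addn1 prednK ?modnn //; lia.
    rewrite addn1 modn_small //; lia.
  by case: ifP.
(* At [4 * (n + 1)] the sign differs from the value of [f n]; the shift by one keeps [e 0] false. *)
pose e k := if (k %% 4 == 0)%N then (0 < k)%N && (f (k %/ 4).-1 k != Some (-1))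
  else (k %% 4 == 2)%N && [exists i : 'I_(k %/ 4).+1, i * i == k %/ 4]%N.
have eodd i : odd i -> ~~ e i.
  by move=> oi; rewrite /e !ifN //; lia.
have [//|x [xirr d14 _ xJ]] := exists_jacobi_seq_of R e _ eodd.
have [||n nE] := fP (fun k => Some ((-1) ^+ e k)).
- apply: not_eventually_periodic_squares => m; rewrite /e.
  by rewrite (mulnC 4) modnMDl divnMDl //= addn0.
- by exists x.
have := nE (4 * n.+1)%N; rewrite /e modnMr eqxx muln_gt0 /= mulKn //=.
by case: eqP => [-> //|H /H].
Qed.
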